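(* Let $X$ and $Y$ be disjoint finite sets and let $R \subseteq X \times Y$ be a relation. Let $B := \{\text{bicliques of } R\} \cup C_X \cup C_Y$ (the biclique complex of $R$). Then $B$ collapses to $C_X$ and $B$ collapses to $C_Y$.
   Context: A simplicial complex with ground set $W$ (a finite set) is a set of subsets of $W$ closed under taking subsets; its elements are faces. Write $x\,R\,y$ for $(x,y) \in R$; for $U \subseteq X$, $V \subseteq Y$, write $U\,\mathbf{R}\,V$ if $u\,R\,v$ for all $u \in U$, $v \in V$. A subset $U \subseteq X$ is $Y$-conic if it is empty or there is $y \in Y$ with $u\,R\,y$ for all $u \in U$; $C_X$ is the set of all $Y$-conic subsets of $X$. A subset $V \subseteq Y$ is $X$-conic if it is empty or there is $x \in X$ with $x\,R\,v$ for all $v \in V$; $C_Y$ is the set of all $X$-conic subsets of $Y$. A biclique of $R$ is a set $U \cup V$ with $U \subseteq X$, $V \subseteq Y$ both nonempty and $U\,\mathbf{R}\,V$. ($B$ is a simplicial complex with ground set $X\cup Y$ containing $C_X$ and $C_Y$.) For faces $A,B$ write $A \prec B$ if $A \subseteq B$ and $|B\setminus A| = 1$. If $\Gamma \subseteq \Delta$ are simplicial complexes and there are faces $\tau,\sigma \in \Delta\setminus\Gamma$ with $\Delta = \Gamma \cup \{\tau,\sigma\}$ and $\tau \prec \sigma$, then $\Delta$ collapses to $\Gamma$ by an elementary collapse. $\Delta$ collapses to $\Gamma$ if there are simplicial complexes $\Delta_0 = \Delta, \Delta_1, \dots, \Delta_n = \Gamma$ ($n \ge 0$) such that each $\Delta_i$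 collapses to $\Delta_{i+1}$ by an elementary collapse. *)

(* Defs.v *)
From mathcomp Require Import all_boot.

Set Implicit Arguments.
Unset Strict Implicit.
Unset Printing Implicit Defensive.

Section SimplicialComplexes.

Variable T : finType.
Implicit Types (W A B sigma tau : {set T}) (Delta Gamma : {set {set T}}).

(* The void complex (no faces, not even the empty one) is allowed. *)
Definition simplicial_complex W Delta : bool :=
  [forall A in Delta, A \subset W] &&
  [forall A in Delta, [forall B : {set T}, (B \subset A) ==> (B \in Delta)]].

Definition covered_by A B : bool := (A \subset B) && (#|B :\: A| == 1).

Definition elementary_collapse W Delta Gamma : bool :=
  [&& simplicial_complex W Delta, simplicial_complex W Gamma,
      Gamma \subset Delta &
      [exists tau in Delta :\: Gamma, exists sigma in Delta :\: Gamma,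
         (Delta == Gamma :|: [set tau; sigma]) && covered_by tau sigma]].

(* The complexes are the successive entries of Delta :: Deltas; the empty
   sequence Deltas is the case where no elementary collapse is performed. *)
Definition collapses_to W Delta Gamma : Prop :=
  exists Deltas : seq {set {set T}},
    [/\ all (simplicial_complex W) (Delta :: Deltas),
        path (elementary_collapse W) Delta Deltas
      & last Delta Deltas = Gamma].

End SimplicialComplexes.

Section Bicliques.

Variable T : finType.
Implicit Types (X Y U V : {set T}) (R : {set T * T}).

Definition set_related R U V : bool :=
  [forall u in U, forall v in V, (u, v) \in R].

(* Y-conic subsets of X *)
Definition conic_left X Y R : {set {set T}} :=
  [set U in powerset X |
    (U == set0) || [exists y in Y, forall u in U, (u, y) \in R]].

(* X-conic subsets of Y *)
Definition conic_right X Y R : {set {set T}} :=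
  [set V in powerset Y |
    (V == set0) || [exists x in X, forall v in V, (x, v) \in R]].

Definition bicliques X Y R : {set {set T}} :=
  [set U :|: V | U : {set T} in powerset X, V : {set T} in powerset Y
               & [&& U != set0, V != set0 & set_related R U V]].

Definition biclique_complex X Y R : {set {set T}} :=
  bicliques X Y R :|: conic_left X Y R :|: conic_right X Y R.

End Bicliques.

(* Main.v *)
(** Above a nonempty X-conic [V], the faces of the biclique complex with
    Y-part [V] are the sets [U :|: V] for all [U] in the common neighbourhood
    of [V], which is nonempty.  Fixing [x] in it, these faces are matched by
    adding or removing [x]; collapsing the matched pairs by decreasing [#|V|],
    then by decreasing [#|U|], leaves the faces with empty Y-part, which form
    C_X.  The collapse to C_Y follows by transposing [R]. *)
Require Import Defs.
From mathcomp Require Import all_boot.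

Set Implicit Arguments.
Unset Strict Implicit.
Unset Printing Implicit Defensive.

(** * Collapsing away all faces that meet a given set *)

Section Collapse.

Variable T : finType.
Implicit Types (W Y A B V : {set T}) (Delta Gamma : {set {set T}}).

Lemma simplicial_complexP W Delta :
  reflect ((forall A, A \in Delta -> A \subset W) /\
           (forall A B, A \in Delta -> B \subset A -> B \in Delta))
          (simplicial_complex W Delta).
Proof.
apply: (iffP andP) => [[/forall_inP sW /forall_inP sD]|[sW sD]].
  by split=> // A B AD BA; apply: (implyP (forallP (sD A AD) B)).
split; apply/forall_inP => // A AD.
by apply/forallP => B; apply/implyP; apply: sD.
Qed.

Lemma collapses_to_refl W Delta :
  simplicial_complex W Delta -> collapses_to W Delta Delta.
Proof. by move=> cD; exists [::]; split=> //=; rewrite cD. Qed.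

Lemma collapses_to_step W Delta Delta' Gamma :
  elementary_collapse W Delta Delta' ->
  collapses_to W Delta' Gamma -> collapses_to W Delta Gamma.
Proof.
move=> eD [Ds [/= cDs pDs <-]]; exists (Delta' :: Ds).
have /and4P[cD _ _ _] := eD.
by split=> //=; rewrite ?cD ?eD.
Qed.

(** Serves twice with [A :\ x] and [A] the pair being collapsed: to show that the pair is free, and
    to show that the cone condition survives its removal. *)
Lemma setU1_between x A B :
  A :\ x \subset B -> x |: B = A -> B = A \/ B = A :\ x.
Proof.
move=> AB defA; have [xB|xB] := boolP (x \in B).
  by left; rewrite -defA (setUidPr _) ?sub1set.
by right; rewrite -defA setU1K.
Qed.

(** Induction on [#|Delta|], one collapsed pair per step. The apex [x] may depend on the trace [V],
    so no global matching has to be carried along: it suffices that the cone condition passes to the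
    complex without the pair. *)
Lemma collapses_to_off Y W Delta :
  simplicial_complex W Delta ->
  (forall V, V != set0 -> V \in [set A :&: Y | A in Delta] ->
     exists2 x, x \notin Y &
       forall A, A \in Delta -> A :&: Y = V -> x |: A \in Delta) ->
  collapses_to W Delta [set A in Delta | A :&: Y == set0].
Proof.
have [n] := ubnP #|Delta|; elim: n Delta => // n IHn Delta leDn cD coneD.
have [sW sD] := simplicial_complexP _ _ cD.
have [/existsP[A0 /andP[A0D A0Y]]|] :=
  boolP [exists A, (A \in Delta) && (A :&: Y != set0)]; last first.
  move=> /existsPn noA; have -> : [set A in Delta | A :&: Y == set0] = Delta.
    apply/setP => A; rewrite inE; case: (boolP (A \in Delta)) => //= AD.
    by move: (noA A); rewrite AD /= negbK.
  exact: collapses_to_refl.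
have A0P : [pred A in Delta | A :&: Y != set0] A0 by rewrite /= A0D.
(* First maximise the size of the trace on [Y], then the size of a face [A] with the trace [V] so
   obtained. The first choice prevents larger traces, the second larger faces over [V]. *)
case: (arg_maxnP (fun A : {set T} => #|A :&: Y|) A0P)
  => A1 /andP[A1D A1Y] maxA1.
pose V := A1 :&: Y.
have A1P : [pred A in Delta | A :&: Y == V] A1 by rewrite /= A1D eqxx.
case: (arg_maxnP (fun A : {set T} => #|A|) A1P) => A /andP[AD /eqP AY] maxA.
have [x xY coneV] : exists2 x, x \notin Y &
    forall B, B \in Delta -> B :&: Y = V -> x |: B \in Delta.
  by apply: coneD => //; apply/imsetP; exists A1.
have U1Y z B : z \notin Y -> (z |: B) :&: Y = B :&: Y.
  move=> zY; rewrite setIUl; have -> : [set z] :&: Y = set0.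
    by apply/eqP; rewrite setI_eq0 disjoints1.
  by rewrite set0U.
have AmaxE B : B \in Delta -> B :&: Y = V -> A \subset B -> B = A.
  move=> BD BY AB; apply/esym/eqP; rewrite eqEcard AB.
  by apply: maxA; rewrite /= BD BY eqxx.
(* Adding [x] to [A] gives a face with the same trace, so by maximality it changes nothing. *)
have xA : x \in A.
  rewrite -(AmaxE (x |: A)) ?setU11 ?subsetUr ?U1Y //; exact: coneV.
have AxY : (A :\ x) :&: Y = V.
  by rewrite -(U1Y x) // setD1K.
have AxD : A :\ x \in Delta by apply: sD AD _; apply: subsetDl.
(* [A :\ x] is a free face: since [x] is outside [Y], the trace of [B] contains [V] and equals it by
   maximality; then [x |: B] is a face over [V] containing [A], hence is [A]. *)
have AxF B : B \in Delta -> A :\ x \subset B -> B = A \/ B = A :\ x.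
  move=> BD AB; have VB : V \subset B :&: Y by rewrite -AxY setSI.
  have BY : B :&: Y = V.
    apply/esym/eqP; rewrite eqEcard VB; apply: maxA1; rewrite /= BD /=.
    by apply: contraNneq A1Y => B0; rewrite -subset0 -B0.
  apply: setU1_between => //; apply: AmaxE; rewrite ?U1Y //; first exact: coneV.
  by rewrite -(setD1K xA) setUS.
pose Delta' := Delta :\: [set A :\ x; A].
have memD' B : (B \in Delta') = [&& B != A :\ x, B != A & B \in Delta].
  by rewrite !inE negb_or andbA.
have cD' : simplicial_complex W Delta'.
  apply/simplicial_complexP; split=> [B|B C].
    by rewrite memD' => /and3P[_ _ /sW].
  rewrite !memD' => /and3P[BAx BA BD] CB; rewrite (sD _ _ BD CB) andbT.
  have nAxB : ~~ (A :\ x \subset B).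
    by apply/negP => /(AxF _ BD) [] E; move: BAx BA; rewrite E eqxx.
  apply/andP; split; apply: contraNneq nAxB => E; rewrite -E //.
  exact: subset_trans (subsetDl _ _) CB.
have sD'D : Delta' \subset Delta by apply: subsetDl.
(* Both removed faces have the nonempty trace [V], so the target of the collapse is unaffected. *)
have -> : [set B in Delta | B :&: Y == set0] =
          [set B in Delta' | B :&: Y == set0].
  apply/setP => B; rewrite 2!inE memD'.
  have [/eqP BY|] := boolP (B :&: Y == set0); rewrite ?andbF // !andbT.
  have [-> ->] // : B != A :\ x /\ B != A.
  by split; apply: contraNneq A1Y => E; rewrite -/V;
    [rewrite -AxY -E BY | rewrite -AY -E BY].
apply: (@collapses_to_step _ _ Delta').
  apply/and4P; split=> //.
  apply/existsP; exists (A :\ x); rewrite !inE AxD eqxx /=.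
  apply/existsP; exists A; rewrite !inE AD eqxx orbT /=.
  apply/andP; split; last first.
    rewrite /covered_by subsetDl setDDr setDv set0U.
    by rewrite (setIidPr _) ?sub1set // cards1.
  rewrite -[X in X == _](setID _ [set A :\ x; A]) setUC (setIidPr _) //.
  by apply/subsetP => B; rewrite !inE => /orP[]/eqP->.
apply: IHn => //.
  apply: leq_trans (_ : #|Delta| <= n) => //; apply: proper_card.
  by apply/properP; split=> //; exists A; rewrite // memD' eqxx andbF.
(* Over a trace other than [V] the old apex still works, because coning keeps the trace and both
   removed faces have trace [V]. *)
move=> V' V'0 /imsetP[C CD' V'C]; have [E|nE] := eqVneq V' V; last first.
  have [|z zY coneV'] := coneD V' V'0.
    by apply/imsetP; exists C => //; apply: (subsetP sD'D).
  exists z => // B /(subsetP sD'D) BD BY; rewrite memD' coneV' // andbT.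
  by apply/andP; split; apply: contraNneq nE => F;
    rewrite -BY -(U1Y z) // F ?AxY ?AY.
(* Over [V] keep the same [x]: [x |: B] contains [x], so it is not [A :\ x]; if it were [A], then
   [B] would itself be one of the removed faces. *)
exists x => // B; rewrite E !memD' => /and3P[BAx BA BD] BY.
rewrite coneV // andbT; apply/andP; split.
  by apply/eqP => F; move: (setU11 x B); rewrite F !inE eqxx.
apply/eqP => F; have AxB : A :\ x \subset B by rewrite subDset F.
by have [] := setU1_between AxB F => G; move: BAx BA; rewrite G eqxx.
Qed.

End Collapse.

(** * The biclique complex, its symmetry under transposition, and its cones *)

Section BicliqueComplex.

Variable T : finType.
Implicit Types (X Y U V A : {set T}) (R : {set T * T}).

Definition transpose R : {set T * T} := [set p | (p.2, p.1) \in R].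

Lemma set_relatedP R U V :
  reflect (forall u v, u \in U -> v \in V -> (u, v) \in R) (set_related R U V).
Proof.
apply: (iffP forall_inP) => [UV u v uU vV|UV u uU].
  exact: (forall_inP (UV u uU)).
by apply/forall_inP => v; apply: UV.
Qed.

Lemma set_related_transpose R U V :
  set_related (transpose R) V U = set_related R U V.
Proof.
apply/set_relatedP/set_relatedP => UV u v uU vV.
  by have := UV v u vV uU; rewrite inE.
by rewrite inE; apply: UV.
Qed.

Lemma conic_left_transpose X Y R :
  conic_left Y X (transpose R) = conic_right X Y R.
Proof.
apply/setP => V; rewrite !inE; congr (_ && (_ || _)).
apply: eq_existsb => x; congr (_ && _).
by apply: eq_forallb => v; rewrite inE.
Qed.

Lemma conic_right_transpose X Y R :
  conic_right Y X (transpose R) = conic_left X Y R.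
Proof.
apply/setP => U; rewrite !inE; congr (_ && (_ || _)).
apply: eq_existsb => y; congr (_ && _).
by apply: eq_forallb => u; rewrite inE.
Qed.

Lemma conic_leftS X Y R U U' :
  U \in conic_left X Y R -> U' \subset U -> U' \in conic_left X Y R.
Proof.
rewrite !inE => /andP[UX cU] sU; rewrite (subset_trans sU UX) /=.
case/orP: cU sU => [/eqP->|/exists_inP[y yY yU] sU].
  by rewrite subset0 => ->.
apply/orP; right; apply/exists_inP; exists y => //.
by apply/forall_inP => u /(subsetP sU); apply: (forall_inP yU).
Qed.

Lemma conic_rightS X Y R V V' :
  V \in conic_right X Y R -> V' \subset V -> V' \in conic_right X Y R.
Proof. by rewrite -!conic_left_transpose; apply: conic_leftS. Qed.

Lemma set_related_conic_left X Y R U V :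
  U \subset X -> V \subset Y -> V != set0 -> set_related R U V ->
  U \in conic_left X Y R.
Proof.
move=> UX VY /set0Pn[v vV] /set_relatedP UV; rewrite !inE UX /=.
apply/orP; right; apply/exists_inP; exists v; first exact: (subsetP VY).
by apply/forall_inP => u uU; apply: UV.
Qed.

Lemma set_related_conic_right X Y R U V :
  U \subset X -> V \subset Y -> U != set0 -> set_related R U V ->
  V \in conic_right X Y R.
Proof.
rewrite -conic_left_transpose -set_related_transpose => UX VY.
exact: set_related_conic_left.
Qed.

(** One criterion covers the three kinds of faces. If both traces are nonempty, relatedness already
    makes them conic; if one is empty, relatedness is vacuous and only conicity of the other
    matters. *)
Lemma mem_biclique_complex X Y R A : [disjoint X & Y] ->
  (A \in biclique_complex X Y R) =
  [&& A \subset X :|: Y, A :&: X \in conic_left X Y R,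
      A :&: Y \in conic_right X Y R & set_related R (A :&: X) (A :&: Y)].
Proof.
move=> dXY; have XY0 : X :&: Y = set0 by apply/eqP; rewrite setI_eq0.
have related0l V : set_related R set0 V.
  by apply/set_relatedP => u v; rewrite inE.
have related0r U : set_related R U set0.
  by apply/set_relatedP => u v _; rewrite inE.
have left0 : set0 \in conic_left X Y R by rewrite !inE sub0set eqxx.
have right0 : set0 \in conic_right X Y R by rewrite !inE sub0set eqxx.
have leftX U : U \in conic_left X Y R -> U \subset X.
  by rewrite !inE => /andP[].
have rightY V : V \in conic_right X Y R -> V \subset Y.
  by rewrite !inE => /andP[].
have IYX U : U \subset X -> U :&: Y = set0.
  by move=> UX; apply/eqP; rewrite -subset0 -XY0 setSI.
have IXY V : V \subset Y -> V :&: X = set0.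
  by move=> VY; apply/eqP; rewrite -subset0 -XY0 (setIC X) setSI.
apply/idP/and4P => [|[AXY AX AY rA]].
  rewrite !in_setU -orbA => /or3P[/imset2P[U V] | AX | AY].
  - rewrite powersetE => UX; rewrite inE powersetE => /and4P[VY U0 V0 UV] ->.
    rewrite !setIUl (setIidPl UX) (setIidPl VY) IYX // IXY // setU0 set0U.
    split=> //; first exact: setUSS; first exact: set_related_conic_left UV.
    exact: set_related_conic_right UV.
  - have sAX := leftX _ AX; rewrite (setIidPl sAX) IYX //.
    by split=> //; apply: subset_trans sAX (subsetUl _ _).
  - have sAY := rightY _ AY; rewrite (setIidPl sAY) IXY //.
    by split=> //; apply: subset_trans sAY (subsetUr _ _).
have defA : A = (A :&: X) :|: (A :&: Y) by rewrite -setIUr (setIidPl AXY).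
rewrite !in_setU; have [X0|AX0] := eqVneq (A :&: X) set0.
  by rewrite defA X0 set0U AY orbT.
have [Y0|AY0] := eqVneq (A :&: Y) set0.
  by rewrite defA Y0 setU0 AX orbT.
apply/orP; left; apply/orP; left; apply/imset2P.
exists (A :&: X) (A :&: Y) => //; first by rewrite inE subsetIr.
by rewrite !inE subsetIr AX0 AY0.
Qed.

Lemma biclique_complex_transpose X Y R : [disjoint X & Y] ->
  biclique_complex Y X (transpose R) = biclique_complex X Y R.
Proof.
move=> dXY; apply/setP => A; rewrite !mem_biclique_complex //; last first.
  by rewrite disjoint_sym.
rewrite conic_left_transpose conic_right_transpose set_related_transpose.
by rewrite setUC; congr (_ && _); rewrite andbCA.
Qed.

Lemma simplicial_biclique_complex X Y R : [disjoint X & Y] ->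
  simplicial_complex (X :|: Y) (biclique_complex X Y R).
Proof.
move=> dXY; apply/simplicial_complexP; split=> [A|A B].
  by rewrite mem_biclique_complex // => /and4P[].
rewrite !mem_biclique_complex // => /and4P[AXY AX AY /set_relatedP rA] BA.
apply/and4P; split; first exact: subset_trans BA AXY.
- exact: conic_leftS AX (setSI _ BA).
- exact: conic_rightS AY (setSI _ BA).
apply/set_relatedP => u v uB vB.
by apply: rA;
  [apply: (subsetP (setSI _ BA) u) | apply: (subsetP (setSI _ BA) v)].
Qed.

Lemma biclique_complex_off X Y R : [disjoint X & Y] ->
  [set A in biclique_complex X Y R | A :&: Y == set0] = conic_left X Y R.
Proof.
move=> dXY; apply/setP => A; rewrite in_set.
apply/andP/idP => [[]|AX].
  rewrite mem_biclique_complex // => /and4P[AXY AX _ _] /eqP Y0.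
  by rewrite -(setIidPl AXY) setIUr Y0 setU0.
split; first by rewrite !in_setU AX orbT.
move: AX; rewrite !inE => /andP[AX _].
by rewrite setI_eq0; apply: disjointWl AX dXY.
Qed.

(** As [x] is related to all of [V], enlarging the X-part by [x] keeps the two parts related. Any
    element of the nonempty [V] then witnesses that the enlarged X-part is conic. *)
Lemma biclique_complex_cone X Y R A V x : [disjoint X & Y] ->
  x \in X -> V \subset Y -> V != set0 -> {in V, forall v, (x, v) \in R} ->
  A \in biclique_complex X Y R -> A :&: Y = V ->
  x |: A \in biclique_complex X Y R.
Proof.
move=> dXY xX VY V0 xV; rewrite !mem_biclique_complex //.
move=> /and4P[AXY AX AY /set_relatedP rA] defV.
have xAY : (x |: A) :&: Y = A :&: Y.
  apply/setP => z; rewrite !inE; case: eqP => // ->.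
  by rewrite (disjointFr dXY xX) !andbF.
have rxA : set_related R ((x |: A) :&: X) ((x |: A) :&: Y).
  rewrite xAY; apply/set_relatedP => u v.
  case/setIP=> /setU1P[-> _|uA uX] vA; first by rewrite xV // -defV.
  by apply: rA; rewrite // inE uA.
apply/and4P; split=> //.
- by rewrite subUset sub1set inE xX.
- by apply: set_related_conic_left rxA; rewrite ?subsetIr // xAY defV.
- by rewrite xAY.
Qed.

Lemma biclique_complex_collapses_left X Y R : [disjoint X & Y] ->
  collapses_to (X :|: Y) (biclique_complex X Y R) (conic_left X Y R).
Proof.
move=> dXY; rewrite -(biclique_complex_off R dXY).
apply: collapses_to_off; first exact: simplicial_biclique_complex.
move=> V V0 /imsetP[A].
rewrite mem_biclique_complex // => /and4P[_ _ AY _] defV.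
(* The apex is the witness of conicity of [V], which exists because [V] is nonempty; disjointness
   puts it outside [Y]. *)
move: AY; rewrite -defV !inE (negbTE V0) => /andP[VY /exists_inP[x xX xV]].
exists x => [|B]; first by rewrite (disjointFr dXY xX).
by apply: biclique_complex_cone xX VY V0 _ => // v; apply: (forall_inP xV).
Qed.

End BicliqueComplex.

Theorem theorem6p1 (T : finType) (X Y : {set T}) (R : {set T * T})
    (disjXY : [disjoint X & Y]) (subR : R \subset setX X Y) :
  collapses_to (X :|: Y) (biclique_complex X Y R) (conic_left X Y R) /\
  collapses_to (X :|: Y) (biclique_complex X Y R) (conic_right X Y R).
Proof.
split; first exact: biclique_complex_collapses_left.
rewrite -biclique_complex_transpose // -conic_left_transpose setUC.
by apply: biclique_complex_collapses_left; rewrite disjoint_sym.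
Qed.
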